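(* Let $M$ be a smooth manifold of dimension $m$, and let $\Omega^{*-1}(M;TM)$ carry the Nijenhuis–Richardson bracket $[\ ,\ ]^\wedge$. Then: (1) $\mathcal C^{*-1}(M)$ is a graded Lie subalgebra of $(\Omega^{*-1}(M;TM),[\ ,\ ]^\wedge)$. (2) $\Omega^*(M)\wedge\mathbf I=\{\varphi\wedge\mathbf I:\varphi\in\Omega^*(M)\}$ is a graded Lie subalgebra of $(\Omega^{*-1}(M;TM),[\ ,\ ]^\wedge)$. Therefore $(\Omega^*(M),[\ ,\ ]^\wedge)$ is a graded Lie algebra, where the induced bracket, satisfying $[\varphi\wedge\mathbf I,\psi\wedge\mathbf I]^\wedge=[\varphi,\psi]^\wedge\wedge\mathbf I$, is, for $\varphi\in\Omega^k(M)$ and $\psi\in\Omega^\ell(M)$, $$[\varphi,\psi]^\wedge=(\ell-k)\,\varphi\wedge\psi=\varphi\wedge i_{\mathbf I}\psi-(-1)^{k\ell}\psi\wedge i_{\mathbf I}\varphi .$$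
   Context: $\Omega(M;TM)=\bigoplus_{k=0}^m\Omega^k(M;TM)$ is the space of $TM$-valued differential forms; $\Omega^{*-1}(M;TM)$ denotes the same space with grading shifted so that $K\in\Omega^k(M;TM)$ has degree $k-1$. The insertion operator is given by $i(\varphi\otimes X)\omega=\varphi\wedge i_X\omega$ for $\omega\in\Omega(M)$ and by $i(K)(\psi\otimes Y)=(i(K)\psi)\otimes Y$ on vector valued forms; $i_K=i(K)$. The Nijenhuis–Richardson bracket is the graded Lie bracket on $\Omega^{*-1}(M;TM)$ given, for $K\in\Omega^k(M;TM)$ and $L\in\Omega^\ell(M;TM)$, by $$[K,L]^\wedge=i(K)L-(-1)^{(k-1)(\ell-1)}i(L)K.$$ The contraction $c:\Omega^k(M;TM)\to\Omega^{k-1}(M)$ is the linear extension of $c(\varphi\otimes X)=i_X\varphi$; $\mathcal C^k(M)=\{K\in\Omega^k(M;TM):c(K)=0\}$, and $\mathcal C^{*-1}(M)$ is $\bigoplus_{k=0}^m\mathcal C^k(M)$ with $\mathcal C^k(M)$ in degree $k-1$. $\mathbf I=\mathrm{Id}_{TM}\in\Omega^1(M;TM)$, locally $\sum_i dx^i\otimes\partial_i$, and $\varphi\wedge\mathbf I=\sum_i(\varphi\wedge dx^i)\otimes\partial_i$; $i_{\mathbf I}\varphi=k\varphi$ for $\varphi\in\Omega^k(M)$. On $\Omega^*(M)$ a $k$-form has degree $k$. A graded Lie algebra has a degree-$0$ bilinear bracket with $[a,b]=-(-1)^{|a||b|}[b,a]$ and the graded Jacobi identity. *)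

(* Defs.v *)
From HB Require Import structures.
From mathcomp Require Import all_boot all_order all_algebra.
From mathcomp Require Import all_classical all_reals all_analysis.
Set Implicit Arguments.
Unset Strict Implicit.
Unset Printing Implicit Defensive.
Import Order.TTheory GRing.Theory Num.Theory.
Import numFieldNormedType.Exports.
Local Open Scope classical_set_scope.
Local Open Scope ring_scope.

(* The sum over all degrees k of the W-valued k-multilinear maps on V is
   encoded as the functions on finite sequences of vectors: the component of
   degree k is the restriction to the sequences of length k. *)
Section MultilinearAlgebra.
Context {R : pzRingType} {V W : lmodType R}.

Definition multilinear (f : seq V -> W) : Prop :=
  forall (s t : seq V) (r : R) (u v : V),
    f (s ++ (r *: u + v) :: t) = r *: f (s ++ u :: t) + f (s ++ v :: t).

Definition alternating (f : seq V -> W) : Prop :=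
  forall (s t q : seq V) (u : V), f (s ++ u :: t ++ u :: q) = 0.

(* Vanishes outside degree k; for k < 0 this forces f = 0. *)
Definition homogeneous (k : int) (f : seq V -> W) : Prop :=
  forall s : seq V, (size s)%:Z <> k -> f s = 0.

Definition iprod (v : V) (f : seq V -> W) : seq V -> W :=
  fun s => f (v :: s).

(* A mask b stands for the shuffle that moves the selected entries in front of
   the others; its sign is -1 to the number of pairs of positions i < j with i
   not selected and j selected. *)
Fixpoint shuffle_inversions (b : seq bool) : nat :=
  if b is c :: b' then
    ((if c then 0 else count id b') + shuffle_inversions b')%N
  else 0%N.

(* Exterior product in the shuffle normalisation
   (f /\ g)(v_1, ..., v_n) = 1/(p! q!) sum over the permutations sigma of
   sign(sigma) f(v_sigma(1), ..., v_sigma(p)) g(v_sigma(p+1), ...)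
   when f has degree p, g has degree q and n = p + q. *)
Definition wedge (f : seq V -> R^o) (g : seq V -> W) : seq V -> W :=
  fun s => \sum_(b : (size s).-tuple bool)
    (-1) ^+ shuffle_inversions b *:
      ((f (mask b s) : R) *: g (mask [seq ~~ c | c <- b] s)).

Definition tensor_vec (f : seq V -> R^o) (w : W) : seq V -> W :=
  fun s => (f s : R) *: w.

End MultilinearAlgebra.

Definition linear_form {R : pzRingType} {V : lmodType R} (f : V -> R) :
    seq V -> R^o :=
  fun s => if s is [:: v] then f v else 0.

Definition identity_form {R : pzRingType} {V : lmodType R} : seq V -> V :=
  fun s => if s is [:: v] then v else 0.

Section Smooth.
Context {R : realType} {V W : normedModType R}.

Definition iter_derive (vs : seq V) (f : V -> W) : V -> W :=
  foldr (fun v g => fun x => 'D_v g x) f vs.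

Definition smooth_on (U : set V) (f : V -> W) : Prop :=
  forall (vs : seq V) (x : V), U x -> differentiable (iter_derive vs f) x.

End Smooth.

(* Hausdorff second countable manifold without boundary, with a smooth atlas
   indexed by [chart_index]; only the maximal atlas it generates matters.
   [chart_inv a] is the inverse of [chart_coord a] on its image; the values of
   both maps outside [chart_dom a], respectively that image, are irrelevant. *)
Record smooth_manifold (R : realType) (m : nat) := SmoothManifold {
  points :> topologicalType;
  manifold_hausdorff : hausdorff_space points;
  manifold_second_countable : @second_countable points;
  chart_index : Type;
  chart_dom : chart_index -> set points;
  chart_coord : chart_index -> points -> 'rV[R]_m;
  chart_inv : chart_index -> 'rV[R]_m -> points;
  chart_cover : forall x, exists a, chart_dom a x;
  open_chart_dom : forall a, open (chart_dom a);
  open_chart_image : forall a, open (chart_coord a @` chart_dom a);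
  coordK : forall a x, chart_dom a x -> chart_inv a (chart_coord a x) = x;
  continuous_coord : forall a x,
    chart_dom a x -> {for x, continuous (chart_coord a)};
  continuous_chart_inv : forall a y,
    (chart_coord a @` chart_dom a) y -> {for y, continuous (chart_inv a)};
  smooth_transition : forall a b,
    smooth_on (chart_coord a @` (chart_dom a `&` chart_dom b))
              (chart_coord b \o chart_inv a) }.

(* Sections of a family of modules. *)
Section DependentFunctions.
Variables (R : pzRingType) (I : Type) (E : I -> lmodType R).

Definition sections := forall i, E i.

HB.instance Definition _ := gen_eqMixin sections.
HB.instance Definition _ := gen_choiceMixin sections.

Implicit Types f g h : sections.

Let add f g : sections := fun i => f i + g i.
Let zero : sections := fun i => 0.
Let opp f : sections := fun i => - f i.
Let scale (r : R) f : sections := fun i => r *: f i.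

Fact sections_addA : associative add.
Proof. by move=> f g h; apply: functional_extensionality_dep => i; exact: addrA. Qed.
Fact sections_addC : commutative add.
Proof. by move=> f g; apply: functional_extensionality_dep => i; exact: addrC. Qed.
Fact sections_add0 : left_id zero add.
Proof. by move=> f; apply: functional_extensionality_dep => i; exact: add0r. Qed.
Fact sections_addN : left_inverse zero opp add.
Proof. by move=> f; apply: functional_extensionality_dep => i; exact: addNr. Qed.

HB.instance Definition _ := GRing.isZmodule.Build sections
  sections_addA sections_addC sections_add0 sections_addN.

Fact sections_scaleA r q f : scale r (scale q f) = scale (r * q) f.
Proof. by apply: functional_extensionality_dep => i; exact: scalerA. Qed.
Fact sections_scale1 : left_id 1 scale.
Proof. by move=> f; apply: functional_extensionality_dep => i; exact: scale1r. Qed.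
Fact sections_scaleDr : right_distributive scale +%R.
Proof. by move=> r f g; apply: functional_extensionality_dep => i; exact: scalerDr. Qed.
Fact sections_scaleDl f : {morph scale^~ f : r q / r + q}.
Proof. by move=> r q; apply: functional_extensionality_dep => i; exact: scalerDl. Qed.

HB.instance Definition _ := GRing.Zmodule_isLmodule.Build R sections
  sections_scaleA sections_scale1 sections_scaleDr sections_scaleDl.

End DependentFunctions.

Section TangentBundle.
Context {R : realType} {m : nat} (M : smooth_manifold R m).
Implicit Types (x : M) (a b c : chart_index M).

(* Tangent vectors are row vectors, on which Jacobians act on the right. *)
Definition transition_jacobian a b x : 'M[R]_m :=
  jacobian (chart_coord b \o chart_inv a) (chart_coord a x).

Lemma differentiable_transition a b x : chart_dom a x -> chart_dom b x ->
  differentiable (chart_coord b \o chart_inv a) (chart_coord a x).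
Proof.
by move=> ax bx; apply: (@smooth_transition _ _ M a b [::]); exists x.
Qed.

Lemma mul_transition_jacobian a b x (v : 'rV[R]_m) :
  chart_dom a x -> chart_dom b x ->
  v *m transition_jacobian a b x =
  'D_v (chart_coord b \o chart_inv a) (chart_coord a x).
Proof.
move=> ax bx; rewrite -(deriveEjacobian v (differentiable_transition ax bx)).
by [].
Qed.

Lemma transition_jacobian_comp a b c x :
  chart_dom a x -> chart_dom b x -> chart_dom c x ->
  transition_jacobian a b x *m transition_jacobian b c x =
  transition_jacobian a c x.
Proof.
move=> ax bx cx.
have near_comp : \forall y \near chart_coord a x, (chart_coord c \o chart_inv a) y =
    ((chart_coord c \o chart_inv b) \o (chart_coord b \o chart_inv a)) y.
  have : \forall y \near chart_coord a x, chart_dom b (chart_inv a y).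
    have := @continuous_chart_inv _ _ M a (chart_coord a x).
    move=> /(_ (ex_intro2 _ _ x ax erefl)) /(_ (chart_dom b)); apply.
    rewrite /= coordK//.
    by apply: open_nbhs_nbhs; split => //; exact: open_chart_dom.
  by apply: filterS => y by_ /=; rewrite coordK.
have Jac v := mul_transition_jacobian v ax cx.
have Jab v := mul_transition_jacobian v ax bx.
have Jbc v := mul_transition_jacobian v bx cx.
move: Jac Jab Jbc; move: (transition_jacobian a c x) => J.
move: (transition_jacobian a b x) (transition_jacobian b c x) => J1 J2.
move=> Jac Jab Jbc; apply/row_matrixP => i.
rewrite (rowE i (J1 *m J2)) (rowE i J) mulmxA Jab Jbc Jac.
have dab := differentiable_transition ax bx.
have dbc := differentiable_transition bx cx.
have dbc' : differentiable (chart_coord c \o chart_inv b)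
    ((chart_coord b \o chart_inv a) (chart_coord a x)) by rewrite /= coordK.
rewrite (near_eq_derive _ near_comp) (deriveE _ (differentiable_comp dab dbc')).
rewrite (diff_comp dab dbc') (deriveE _ dbc) (deriveE _ dab).
by move: (coordK ax) => /= ->.
Qed.

Definition tangent_compatible x :
    {pred ({a | chart_dom a x} -> 'rV[R]_m)} :=
  [pred v : {a | chart_dom a x} -> 'rV[R]_m | `[< forall p q,
    v q = v p *m transition_jacobian (sval p) (sval q) x >]].

Arguments tangent_compatible x v : clear implicits.

Lemma tangent_compatible_submod x : submod_closed (tangent_compatible x).
Proof.
split; first by apply/asboolP => a b; rewrite mul0mx.
move=> r u v /asboolP uP /asboolP vP; apply/asboolP => p q /=.
by rewrite !fctE /= [u q](uP p q) [v q](vP p q) mulmxDl scalemxAl.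
Qed.

HB.instance Definition _ x := GRing.isSubmodClosed.Build R
  ({a | chart_dom a x} -> 'rV[R]_m) (tangent_compatible x)
  (tangent_compatible_submod x).

(* T_x M: a tangent vector is given by its components in every chart around x,
   related by the Jacobians of the coordinate changes. *)
Record tangent x := Tangent {
  components : {a | chart_dom a x} -> 'rV[R]_m;
  tangentP : components \in tangent_compatible x }.

HB.instance Definition _ x := [isSub of tangent x for @components x].
HB.instance Definition _ x := [Choice of tangent x by <:].
HB.instance Definition _ x := [SubChoice_isSubLmodule of tangent x by <:].

(* The coordinate vector field d/dx^i of the chart a, extended by 0 outside the
   chart domain. *)
Fact coord_vector_subproof a (i : 'I_m) x (ax : chart_dom a x) :
  (fun p : {b | chart_dom b x} =>
     delta_mx 0 i *m transition_jacobian a (sval p) x)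
    \in tangent_compatible x.
Proof.
apply/asboolP => -[b bx] [c cx] /=.
by rewrite -mulmxA (transition_jacobian_comp ax bx cx).
Qed.

Definition coord_vector a (i : 'I_m) x : tangent x :=
  if pselect (chart_dom a x) is left ax
  then Tangent (coord_vector_subproof i ax) else 0.

(* The coordinate 1-form dx^i of the chart a, extended likewise. *)
Definition dcoord a (i : 'I_m) x (v : tangent x) : R :=
  if pselect (chart_dom a x) is left ax then components v (exist _ a ax) 0 i else 0.

Definition chart_at x : chart_index M := sval (cid (chart_cover x)).

End TangentBundle.

Section Forms.
Context {R : realType} {m : nat} (M : smooth_manifold R m).
Implicit Types (x : M) (a : chart_index M).

(* Not necessarily alternating, multilinear or smooth; [Omega] and [vOmega]
   below single out the differential forms. *)
Definition dform := sections (fun x : M => (seq (tangent x) -> R^o : lmodType R)).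
Definition vform :=
  sections (fun x : M => (seq (tangent x) -> tangent x : lmodType R)).

HB.instance Definition _ := GRing.Lmodule.on dform.
HB.instance Definition _ := GRing.Lmodule.on vform.

Definition smooth_form (w : dform) : Prop :=
  forall a (js : seq 'I_m),
    smooth_on (chart_coord a @` chart_dom a)
      (fun y => let x := chart_inv a y in
         w x [seq coord_vector a j x | j <- js] : R^o).

Definition smooth_vform (K : vform) : Prop :=
  forall a (i : 'I_m) (js : seq 'I_m),
    smooth_on (chart_coord a @` chart_dom a)
      (fun y => let x := chart_inv a y in
         dcoord a i (K x [seq coord_vector a j x | j <- js]) : R^o).

(* The k-forms on M; they vanish unless 0 <= k <= m. *)
Definition Omega (k : int) : set dform := [set w |
  (forall x, [/\ multilinear (w x), alternating (w x) & homogeneous k (w x)])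
  /\ smooth_form w].

(* The TM-valued k-forms on M *)
Definition vOmega (k : int) : set vform := [set K |
  (forall x, [/\ multilinear (K x), alternating (K x) & homogeneous k (K x)])
  /\ smooth_vform K].

Definition form_wedge (f g : dform) : dform := fun x => wedge (f x) (g x).

(* K^i, where K = sum_i K^i (x) d/dx^i in the chart chosen at x; (x) stands for
   the tensor product. *)
Definition vform_coef (K : vform) x (i : 'I_m) : seq (tangent x) -> R^o :=
  fun s => dcoord (chart_at x) i (K x s).

(* i(phi (x) X) w = phi /\ i_X w applied to K = sum_i K^i (x) d/dx^i; on
   [vOmega] the result does not depend on the chart, and for vector valued w it acts on the
   form factor, since [wedge] and [iprod] do. *)
Definition insertion_at (K : vform) x (W : lmodType R)
    (w : seq (tangent x) -> W) : seq (tangent x) -> W :=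
  \sum_i wedge (vform_coef K i) (iprod (coord_vector (chart_at x) i x) w).

Definition insertion (K : vform) (w : dform) : dform :=
  fun x => insertion_at K (w x).

Definition vinsertion (K L : vform) : vform :=
  fun x => insertion_at K (L x).

(* c(phi (x) X) = i_X phi applied to K = sum_i K^i (x) d/dx^i *)
Definition contraction_form (K : vform) : dform := fun x =>
  \sum_i iprod (coord_vector (chart_at x) i x) (vform_coef K i).

Definition idTM : vform := fun x => identity_form.

(* phi /\ I = sum_i (phi /\ dx^i) (x) d/dx^i *)
Definition wedge_idTM (f : dform) : vform := fun x =>
  \sum_i tensor_vec (wedge (f x) (linear_form (@dcoord _ _ _ (chart_at x) i x)))
                (coord_vector (chart_at x) i x).

(* The Nijenhuis-Richardson bracket of a k-form and an l-form *)
Definition NR_bracket (k l : int) (K L : vform) : vform :=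
  vinsertion K L - ((-1 : R) ^ ((k - 1) * (l - 1))) *: vinsertion L K.

Definition trace_free (k : int) : set vform :=
  [set K | vOmega k K /\ contraction_form K = 0].

Definition Omega_wedge_idTM (k : int) : set vform :=
  [set wedge_idTM f | f in Omega k].

Definition form_bracket (k l : int) (f g : dform) : dform :=
  ((l - k)%:~R : R) *: form_wedge f g.

End Forms.

Arguments Omega {R m} M k.
Arguments vOmega {R m} M k.
Arguments trace_free {R m} M k.
Arguments Omega_wedge_idTM {R m} M k.
Arguments idTM {R m} M.
Arguments NR_bracket {R m M} k l K L.
Arguments form_bracket {R m M} k l f g.

(* A graded vector space is given by its homogeneous components L a, as
   subspaces of a common vector space; a degree 0 bracket on it is a family of
   bilinear maps br a b : L a x L b -> L (a + b). *)
Section GradedLieAlgebra.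
Context {R : fieldType} {V : lmodType R}.

Definition graded_subspace (L : int -> set V) : Prop :=
  forall a, L a 0 /\
    forall (r : R) (x y : V), L a x -> L a y -> L a (r *: x + y).

Record graded_lie_algebra (L : int -> set V)
    (br : int -> int -> V -> V -> V) : Prop := GradedLieAlgebra {
  graded_lie_subspace : graded_subspace L;
  graded_lie_closed : forall a b x y,
    L a x -> L b y -> L (a + b) (br a b x y);
  graded_lie_linear_l : forall a b (r : R) x x' y,
    L a x -> L a x' -> L b y ->
    br a b (r *: x + x') y = r *: br a b x y + br a b x' y;
  graded_lie_linear_r : forall a b (r : R) x y y',
    L a x -> L b y -> L b y' ->
    br a b x (r *: y + y') = r *: br a b x y + br a b x y';
  graded_lie_antisym : forall a b x y,
    L a x -> L b y -> br a b x y = - ((-1 : R) ^ (a * b) *: br b a y x);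
  graded_lie_jacobi : forall a b c x y z,
    L a x -> L b y -> L c z ->
    br a (b + c) x (br b c y z) =
      br (a + b) c (br a b x y) z
      + (-1 : R) ^ (a * b) *: br b (a + c) y (br a c x z) }.

Record graded_lie_subalgebra (L : int -> set V)
    (br : int -> int -> V -> V -> V) (S : int -> set V) : Prop :=
  GradedLieSubalgebra {
  graded_lie_ambient : graded_lie_algebra L br;
  graded_lie_sub : forall a, S a `<=` L a;
  graded_lie_sub_subspace : graded_subspace S;
  graded_lie_sub_closed : forall a b x y,
    S a x -> S b y -> S (a + b) (br a b x y) }.

End GradedLieAlgebra.

(* Main.v *)
Require Import Defs.
From HB Require Import structures.
From mathcomp Require Import all_boot all_order all_algebra.
From mathcomp Require Import all_classical all_reals all_analysis.
From mathcomp Require Import ring.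
Set Implicit Arguments.
Unset Strict Implicit.
Unset Printing Implicit Defensive.
Import Order.TTheory GRing.Theory Num.Theory.
Local Open Scope ring_scope.

(** Everything except smoothness is a pointwise statement about alternating
multilinear forms on a vector space with a frame e_i and dual coframe theta^i.
Interior products satisfy i_v (f /\ g) = i_v f /\ g + (-1)^k f /\ i_v g for f of
degree k ([iprod_wedge]). With forms as functions on sequences, this is a
recursion on the sequence of arguments which gives associativity and graded
commutativity of the exterior product by induction ([wedgeA], [wedgeC]).

Write i(K) w = sum of K^i /\ i_{e_i} w. The derivation property gives
i(K) i(L) w = i(i(K) L) w + Q(K, L) w, where Q collects the terms in which both
interior products act on w; since interior products anticommute, Q is graded
symmetric in the shifted degrees ([insertion_insertion],
[double_insertion_sym]). Hence i maps the Nijenhuis-Richardson bracket to the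
graded commutator ([insertion_bracket]), and the Jacobi identity follows
([nr_bracket_jacobi]): insertion is a graded pre-Lie product.

The contraction c is the trace of the components. When c(L) = 0, c(i(K) L) is
the sum of i_{e_j} K^i /\ i_{e_i} L^j, again graded symmetric in K and L, so the
bracket of two trace free forms is trace free ([trace_bracket]).

Inserting the identity multiplies a k-form by k, hence i(f /\ I) w = l f /\ w for
w of degree l. With w = g /\ I, of degree l + 1, this yields
[f /\ I, g /\ I] = (l - k) f /\ g /\ I ([wedge_idTM_bracket]). As
c(f /\ I) = (-1)^k (m - k) f for a k-form f, the form f can be recovered from
f /\ I unless k = m ([wedge_idTM_inj]). The Jacobi identity for (l - k) f /\ g is
a polynomial identity in the degrees, which also covers the top degree, where
f /\ I vanishes.

Smoothness concerns the coefficients in a chart. The insertion does not depend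
on the frame ([frame_insertionE]), so in a chart the coefficients of i(K) L are
sums of products of those of K and L; smooth functions are closed under these
operations ([smooth_onM]). *)

(** * Signs with integer exponents *)

Section IntegerSigns.
Variable R : comUnitRingType.
Implicit Types a b : int.

Lemma signz_cases a : (-1 : R) ^ a = 1 \/ (-1 : R) ^ a = -1.
Proof.
case: (intP a) => [|n|n]; rewrite ?expr0z; first by left.
- by rewrite -exprnP -signr_odd; case: odd; [right|left].
- rewrite -invr_expz -exprnP -signr_odd; case: odd.
    by rewrite expr1 invrN1; right.
  by rewrite expr0 invr1; left.
Qed.

Lemma signzD a b : (-1 : R) ^ (a + b) = (-1) ^ a * (-1) ^ b.
Proof. by rewrite exprzDr// unitrN1. Qed.

Lemma signzN a : (-1 : R) ^ (- a) = (-1) ^ a.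
Proof. by rewrite -invr_expz; case: (signz_cases a) => ->; rewrite ?invr1 ?invrN1. Qed.

(** Turns a sign whose exponent is a product into iterated powers, so that an
identity between such signs follows by testing both values of each factor. *)
Lemma signzM a b : (-1 : R) ^ (a * b) = ((-1) ^ a) ^ b.
Proof. by rewrite exprz_exp. Qed.

Lemma signzz a : (-1 : R) ^ a * (-1) ^ a = 1.
Proof. by case: (signz_cases a) => ->; rewrite ?mulrNN ?mulr1. Qed.

End IntegerSigns.

Definition signzE := (signzD, signzN, signzM, expr1z, exp1rz).

(** * The exterior product of arbitrary functions on sequences *)

Lemma sum_bool_tupleS (W : nmodType) n (F : seq bool -> W) :
  \sum_(b : n.+1.-tuple bool) F b =
  \sum_(b : n.-tuple bool) F (true :: b) + \sum_(b : n.-tuple bool) F (false :: b).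
Proof.
transitivity (\sum_(p : bool * n.-tuple bool) F (p.1 :: p.2)).
  rewrite (reindex (fun p : bool * n.-tuple bool => [tuple of p.1 :: p.2])) //=.
  exists (fun b : n.+1.-tuple bool => (thead b, [tuple of behead b])).
  - move=> [c b] _ /=; congr (_, _).
    by apply: val_inj.
  - by move=> b _; rewrite /= -tuple_eta.
rewrite -(pair_bigA _ (fun c (b : n.-tuple bool) => F (c :: b))) /=.
by rewrite big_bool.
Qed.

Lemma add_funE (T : Type) (W : zmodType) (f g : T -> W) x : (f + g) x = f x + g x.
Proof. by []. Qed.

Lemma scale_funE (R : pzRingType) (T : Type) (W : lmodType R) r (f : T -> W) x :
  (r *: f) x = r *: f x.
Proof. by []. Qed.

Section Wedge.
Context {R : comUnitRingType} {V : lmodType R}.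

(** The grading involution, written so that it makes sense without homogeneity. *)
Definition grade_sign {W : lmodType R} (f : seq V -> W) : seq V -> W :=
  fun s => (-1) ^+ size s *: f s.

Lemma wedge_size (W : lmodType R) n (f : seq V -> R^o) (g : seq V -> W) s :
  size s = n -> wedge f g s = \sum_(b : n.-tuple bool)
    (-1) ^+ shuffle_inversions b *:
      ((f (mask b s) : R) *: g (mask [seq ~~ c | c <- b] s)).
Proof. by move=> <-. Qed.

Lemma wedge_nil (W : lmodType R) (f : seq V -> R^o) (g : seq V -> W) :
  wedge f g [::] = (f [::] : R) *: g [::].
Proof.
rewrite /wedge /= (big_pred1 [tuple]) => [|b] /=; last by rewrite [b]tuple0; apply/esym/eqP.
by rewrite expr0 scale1r.
Qed.

(** Shuffles of v :: s either select v, which then costs no sign, or leave it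
behind all the selected entries, which contributes -1 to their number. This
recursion determines the exterior product; the algebraic laws below follow from
it by induction on the sequence of arguments. *)
Lemma iprod_wedge (W : lmodType R) v (f : seq V -> R^o) (g : seq V -> W) :
  iprod v (wedge f g) = wedge (iprod v f) g + wedge (grade_sign f) (iprod v g).
Proof.
apply/funext => s; rewrite /iprod /wedge /= [RHS]/GRing.add /=.
rewrite (sum_bool_tupleS _ (fun b => (-1) ^+ shuffle_inversions b *:
      ((f (mask b (v :: s)) : R) *: g (mask [seq ~~ c | c <- b] (v :: s))))) /=.
congr (_ + _); apply: eq_bigr => b _; rewrite /grade_sign /=.
rewrite exprD mulrC -scalerA; congr (_ *: _).
rewrite [(_ *: f _ : R)]/GRing.scale /= size_mask ?size_tuple//.
by rewrite scalerA.
Qed.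

Lemma wedge_linear_l (W : lmodType R) (g : seq V -> W) :
  linear ((fun f => wedge f g) : (seq V -> R^o) -> (seq V -> W)).
Proof.
move=> r f1 f2; apply/funext => s; rewrite add_funE scale_funE /wedge.
rewrite scaler_sumr -big_split /=; apply: eq_bigr => b _.
rewrite add_funE scale_funE scalerDl scalerDr; congr (_ + _).
rewrite [RHS]scalerA mulrC -[RHS]scalerA; congr (_ *: _).
by apply/esym; exact: scalerA.
Qed.

Lemma wedge_linear_r (W : lmodType R) (f : seq V -> R^o) :
  linear (wedge f : (seq V -> W) -> (seq V -> W)).
Proof.
move=> r g1 g2; apply/funext => s; rewrite add_funE scale_funE /wedge.
rewrite scaler_sumr -big_split /=; apply: eq_bigr => b _.
rewrite add_funE scale_funE !scalerDr; congr (_ + _).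
by rewrite !scalerA; congr (_ *: _); rewrite mulrA mulrC mulrA.
Qed.

Lemma wedge_bilinear (W : lmodType R) : bilinear_for
  (GRing.Scale.Law.clone R (seq V -> W) *:%R _)
  (GRing.Scale.Law.clone R (seq V -> W) *:%R _)
  (@wedge R V W).
Proof. by split=> [g|f]; [exact: wedge_linear_l|exact: wedge_linear_r]. Qed.

HB.instance Definition _ (W : lmodType R) := bilinear_isBilinear.Build R
  (seq V -> R^o : lmodType R) (seq V -> W : lmodType R) (seq V -> W : zmodType)
  _ _ (@wedge R V W) (wedge_bilinear W).

Lemma iprod_linear (W : lmodType R) (v : V) :
  linear (@iprod R V W v : (seq V -> W) -> (seq V -> W)).
Proof. by []. Qed.
HB.instance Definition _ (W : lmodType R) (v : V) :=
  GRing.isLinear.Build R (seq V -> W) (seq V -> W) *:%R (@iprod R V W v) (iprod_linear v).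

Lemma grade_sign_linear (W : lmodType R) :
  linear (@grade_sign W : (seq V -> W) -> (seq V -> W)).
Proof.
move=> r f g; apply/funext => s; rewrite /grade_sign.
by rewrite !(add_funE, scale_funE) scalerDr !scalerA mulrC.
Qed.
HB.instance Definition _ (W : lmodType R) :=
  GRing.isLinear.Build R (seq V -> W) (seq V -> W) *:%R (@grade_sign W) (@grade_sign_linear W).

Implicit Types (f : seq V -> R^o) (v : V) (s : seq V) (k l : int).

Lemma iprod_grade_sign (W : lmodType R) v (g : seq V -> W) :
  iprod v (grade_sign g) = - grade_sign (iprod v g).
Proof. by apply/funext => s; rewrite /iprod /grade_sign /= exprS mulN1r scaleNr. Qed.

Lemma wedge_cons (W : lmodType R) f (g : seq V -> W) v s :
  wedge f g (v :: s) = wedge (iprod v f) g s + wedge (grade_sign f) (iprod v g) s.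
Proof. by rewrite -[LHS]/(iprod v (wedge f g) s) iprod_wedge. Qed.

Lemma grade_sign_wedge (W : lmodType R) f (g : seq V -> W) :
  grade_sign (wedge f g) = wedge (grade_sign f) (grade_sign g).
Proof.
apply/funext => s; elim: s f g => [|v s IHs] f g.
  by rewrite /grade_sign !wedge_nil /= !expr0 !scale1r.
rewrite -[LHS]/(iprod v (grade_sign _) s) -[RHS]/(iprod v (wedge _ _) s).
rewrite iprod_grade_sign !iprod_wedge !iprod_grade_sign linearNl linearNr linearD /=.
by rewrite -opprD -[LHS]/(- (_ s)) -[RHS]/(- (_ s)) !add_funE !IHs.
Qed.

(** Both sides obey the same three-term recursion. *)
Lemma wedgeA (W : lmodType R) f1 f2 (g : seq V -> W) :
  wedge (wedge f1 f2) g = wedge f1 (wedge f2 g).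
Proof.
apply/funext => s; elim: s f1 f2 g => [|v s IHs] f1 f2 g.
  by rewrite !wedge_nil scalerA.
rewrite !wedge_cons.
by rewrite !iprod_wedge linearDl linearDr /= grade_sign_wedge !add_funE !IHs addrA.
Qed.

Lemma homogeneous_iprod (W : lmodType R) v k (g : seq V -> W) :
  homogeneous k g -> homogeneous (k - 1) (iprod v g).
Proof.
by move=> gk s sk; apply: gk => gk; apply: sk; rewrite -gk intS addrC addKr.
Qed.

Lemma homogeneous_nil (W : lmodType R) k (g : seq V -> W) :
  homogeneous k g -> g [::] != 0 -> k = 0.
Proof. by move=> gk; case: (eqVneq k 0) => // k0; rewrite gk ?eqxx //=; apply/eqP; rewrite eq_sym. Qed.

Lemma grade_sign_homogeneous (W : lmodType R) k (g : seq V -> W) :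
  homogeneous k g -> grade_sign g = (-1) ^ k *: g.
Proof.
move=> gk; apply/funext => s; rewrite scale_funE /grade_sign.
have [<-|/eqP sk] := eqVneq (size s)%:Z k; first by rewrite exprnP.
by rewrite gk ?scaler0.
Qed.

Lemma homogeneous_scale (W : lmodType R) k (r : R) (g : seq V -> W) :
  homogeneous k g -> homogeneous k (r *: g).
Proof. by move=> gk s sk; rewrite scale_funE gk ?scaler0. Qed.

Lemma homogeneous_wedge (W : lmodType R) k l f (g : seq V -> W) :
  homogeneous k f -> homogeneous l g -> homogeneous (k + l) (wedge f g).
Proof.
move=> fk gl s; elim: s k l f g fk gl => [|v s IHs] k l f g fk gl skl.
  rewrite wedge_nil; have [->|/(homogeneous_nil fk) k0] := eqVneq (f [::]) 0.
    by rewrite scale0r.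
  have [->|/(homogeneous_nil gl) l0] := eqVneq (g [::]) 0; first by rewrite scaler0.
  by rewrite k0 l0 in skl.
rewrite wedge_cons.
have skl' : (size s)%:Z <> k + l - 1.
  by move=> skl'; apply: skl; rewrite /= intS skl' addrCA subrr addr0.
rewrite (IHs (k - 1) l) ?(IHs k (l - 1)) ?addr0 ?addrA //.
- by rewrite (grade_sign_homogeneous fk); exact: homogeneous_scale.
- exact: homogeneous_iprod.
- exact: homogeneous_iprod.
- by rewrite addrAC.
Qed.

(** In the recursion for the two sides the terms in iprod v f1 and iprod v f2
trade places; moving a form of degree k past one of degree l - 1 and applying
the grading sign of f1 together cost (-1) ^ (k * l). *)
Lemma wedgeC k l f1 f2 : homogeneous k f1 -> homogeneous l f2 ->
  wedge f1 f2 = (-1) ^ (k * l) *: wedge f2 f1.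
Proof.
move=> f1k f2l; apply/funext => s; rewrite scale_funE.
elim: s k l f1 f2 f1k f2l => [|v s IHs] k l f1 f2 f1k f2l.
  rewrite !wedge_nil.
  have [->|/(homogeneous_nil f1k) ->] := eqVneq (f1 [::]) 0.
    by rewrite scale0r !scaler0.
  by rewrite mul0r expr0z scale1r; exact: mulrC.
rewrite !wedge_cons (grade_sign_homogeneous f1k) (grade_sign_homogeneous f2l).
rewrite !linearZl /= !scale_funE.
rewrite (IHs _ _ _ _ (@homogeneous_iprod _ v _ _ f1k) f2l).
rewrite (IHs _ _ _ _ f1k (@homogeneous_iprod _ v _ _ f2l)).
rewrite scalerDr !scalerA addrC; congr (_ *: _ + _ *: _); last first.
  by rewrite mulrBl mul1r signzD signzN.
rewrite mulrBr mulr1 signzD signzN mulrCA -[RHS]mulr1; congr (_ * _).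
exact: signzz.
Qed.

Definition unit_form : seq V -> R^o := fun s => if s is [::] then 1 else 0.

Lemma wedge1l (W : lmodType R) (g : seq V -> W) : wedge unit_form g = g.
Proof.
apply/funext => s; elim: s g => [|v s IHs] g; first by rewrite wedge_nil scale1r.
rewrite wedge_cons.
rewrite (_ : iprod v unit_form = 0); last by apply/funext => -[].
rewrite linear0l add0r (_ : grade_sign unit_form = unit_form) ?IHs //.
by apply/funext => -[|? ?]; rewrite /grade_sign /= ?scale1r ?scaler0.
Qed.

Lemma homogeneous_unit_form : homogeneous 0 unit_form.
Proof. by case. Qed.

Lemma wedge1r k f : homogeneous k f -> wedge f unit_form = f.
Proof. by move=> fk; rewrite (wedgeC fk homogeneous_unit_form) mulr0 scale1r wedge1l. Qed.

End Wedge.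

(** * Alternating multilinear forms *)

Section AlternatingForms.
Context {R : comUnitRingType} {V : lmodType R}.

Lemma multilinear_iprod (W : lmodType R) v (g : seq V -> W) :
  multilinear g -> multilinear (iprod v g).
Proof. by move=> gm s; exact: gm (v :: s). Qed.

Lemma alternating_iprod (W : lmodType R) v (g : seq V -> W) :
  Defs.alternating g -> Defs.alternating (iprod v g).
Proof. by move=> ga s; exact: ga (v :: s). Qed.

Lemma iprod_linear_vector (W : lmodType R) (g : seq V -> W) : multilinear g ->
  linear ((fun v => iprod v g) : V -> (seq V -> W)).
Proof. by move=> gm r u v; apply/funext => s; exact: gm [::] s r u v. Qed.

Lemma multilinear_linear_comb (W : lmodType R) r (g h : seq V -> W) :
  multilinear g -> multilinear h -> multilinear (r *: g + h).
Proof.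
move=> gm hm s t q u v; rewrite !add_funE !scale_funE gm hm.
by rewrite !scalerDr !scalerA mulrC addrACA.
Qed.

Lemma alternating_linear_comb (W : lmodType R) r (g h : seq V -> W) :
  Defs.alternating g -> Defs.alternating h -> Defs.alternating (r *: g + h).
Proof. by move=> ga ha s t q u; rewrite add_funE scale_funE ga ha scaler0 addr0. Qed.

Lemma homogeneous_linear_comb (W : lmodType R) k r (g h : seq V -> W) :
  homogeneous k g -> homogeneous k h -> homogeneous k (r *: g + h).
Proof. by move=> gk hk s sk; rewrite add_funE scale_funE gk ?hk ?scaler0 ?addr0. Qed.

(** Polarization: expand the value at two adjacent entries u + v. *)
Lemma alternating_swap (W : lmodType R) (g : seq V -> W) : multilinear g ->
  (forall s t u, g (s ++ u :: u :: t) = 0) ->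
  forall s t u v, g (s ++ u :: v :: t) = - g (s ++ v :: u :: t).
Proof.
move=> gm g0 s t u v; apply/eqP; rewrite -addr_eq0; apply/eqP.
have gD s' t' a b : g (s' ++ (a + b) :: t') = g (s' ++ a :: t') + g (s' ++ b :: t').
  by have := gm s' t' 1 a b; rewrite !scale1r.
have gD2 c : g (s ++ c :: (u + v) :: t) = g (s ++ c :: u :: t) + g (s ++ c :: v :: t).
  by rewrite -!(cat_rcons c) gD.
by have := g0 s t (u + v); rewrite gD !gD2 !g0 add0r addr0.
Qed.

(** Equal entries can be brought next to each other by adjacent swaps. For an
exterior product this leaves the adjacent repetitions, which its recursion
reaches by two steps. *)
Lemma alternating_adjacent (W : lmodType R) (g : seq V -> W) : multilinear g ->
  (forall s t u, g (s ++ u :: u :: t) = 0) -> Defs.alternating g.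
Proof.
move=> gm g0 s t q u; elim: t s => [|v t IHt] s; first exact: g0.
by rewrite (alternating_swap gm g0) -cat_rcons IHt oppr0.
Qed.

Lemma iprod_anticomm (W : lmodType R) (g : seq V -> W) u v :
  multilinear g -> Defs.alternating g -> iprod u (iprod v g) = - iprod v (iprod u g).
Proof.
move=> gm ga; apply/funext => s.
by apply: (alternating_swap gm _ [::]) => s' t u'; exact: ga s' [::] t u'.
Qed.

Lemma iprod_iprod (W : lmodType R) (g : seq V -> W) v :
  Defs.alternating g -> iprod v (iprod v g) = 0.
Proof. by move=> ga; apply/funext => s; exact: ga [::] [::] s v. Qed.

Lemma multilinear_grade_sign (W : lmodType R) (g : seq V -> W) :
  multilinear g -> multilinear (grade_sign g).
Proof.
move=> gm s t r u v; rewrite /grade_sign gm scalerDr !scalerA !size_cat /=.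
by rewrite mulrC.
Qed.

Lemma alternating_grade_sign (W : lmodType R) (g : seq V -> W) :
  Defs.alternating g -> Defs.alternating (grade_sign g).
Proof. by move=> ga s t q u; rewrite /grade_sign ga scaler0. Qed.

Lemma multilinear_wedge (W : lmodType R) (f : seq V -> R^o) (g : seq V -> W) :
  multilinear f -> multilinear g -> multilinear (wedge f g).
Proof.
move=> fm gm s; elim: s f g fm gm => [|w s IHs] f g fm gm t r u v.
  rewrite /= !wedge_cons.
  rewrite (iprod_linear_vector fm) (iprod_linear_vector gm).
  by rewrite linearPl linearPr /= !add_funE !scale_funE scalerDr addrACA.
rewrite /= !wedge_cons.
rewrite !IHs ?scalerDr 1?addrACA //.
- exact: multilinear_grade_sign.
- exact: multilinear_iprod.
- exact: multilinear_iprod.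
Qed.

(** At u :: u :: t the terms with both copies of u in one factor vanish, and
the two mixed terms cancel because iprod u anticommutes with the grading
involution. *)
Lemma alternating_wedge (W : lmodType R) (f : seq V -> R^o) (g : seq V -> W) :
  multilinear f -> multilinear g -> Defs.alternating f -> Defs.alternating g ->
  Defs.alternating (wedge f g).
Proof.
move=> fm gm fa ga; apply: alternating_adjacent; first exact: multilinear_wedge.
move=> s t u; elim: s f g fm gm fa ga => [|w s IHs] f g fm gm fa ga /=.
  rewrite -[LHS]/(iprod u (iprod u (wedge _ _)) t) iprod_wedge linearD /=.
  rewrite !iprod_wedge !iprod_iprod // linear0l linear0r add0r addr0.
  by rewrite iprod_grade_sign linearNl subrr.
rewrite wedge_cons !IHs ?addr0 //.
- exact: multilinear_grade_sign.
- exact: multilinear_iprod.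
- exact: alternating_grade_sign.
- exact: alternating_iprod.
- exact: multilinear_iprod.
- exact: alternating_iprod.
Qed.

Definition alt_form {W : lmodType R} (k : int) (g : seq V -> W) : Prop :=
  [/\ multilinear g, Defs.alternating g & homogeneous k g].

Lemma alt_form0 (W : lmodType R) k : alt_form k (0 : seq V -> W).
Proof.
split=> //; by move=> s t r u v; rewrite scaler0 addr0.
Qed.

Lemma alt_form_linear_comb (W : lmodType R) k r (g h : seq V -> W) :
  alt_form k g -> alt_form k h -> alt_form k (r *: g + h).
Proof.
move=> [gm ga gk] [hm ha hk]; split.
- exact: multilinear_linear_comb.
- exact: alternating_linear_comb.
- exact: homogeneous_linear_comb.
Qed.

Lemma alt_form_sum (W : lmodType R) I (r : seq I) k (g : I -> seq V -> W) :
  (forall i, alt_form k (g i)) -> alt_form k (\sum_(i <- r) g i).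
Proof.
move=> gk; elim/big_ind : _ => //; first exact: alt_form0.
by move=> x y xk yk; rewrite -[x]scale1r; exact: alt_form_linear_comb.
Qed.

Lemma alt_form_wedge (W : lmodType R) k l (f : seq V -> R^o) (g : seq V -> W) :
  alt_form k f -> alt_form l g -> alt_form (k + l) (wedge f g).
Proof.
move=> [fm fa fk] [gm ga gl]; split.
- exact: multilinear_wedge.
- exact: alternating_wedge.
- exact: homogeneous_wedge.
Qed.

Lemma alt_form_iprod (W : lmodType R) v k (g : seq V -> W) :
  alt_form k g -> alt_form (k - 1) (iprod v g).
Proof.
move=> [gm ga gk]; split.
- exact: multilinear_iprod.
- exact: alternating_iprod.
- exact: homogeneous_iprod.
Qed.

Lemma alt_form_comp (W W' : lmodType R) k (h : {linear W -> W'}) (g : seq V -> W) :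
  alt_form k g -> alt_form k (h \o g).
Proof.
move=> [gm ga gk]; split.
- by move=> s t r u v /=; rewrite gm linearP.
- by move=> s t q u /=; rewrite ga linear0.
- by move=> s sk /=; rewrite gk ?linear0.
Qed.

Lemma alt_form_identity : alt_form 1 (@identity_form R V).
Proof.
split.
- by move=> [|a [|b s]] [|c t] r u v //=; rewrite scaler0 addr0.
- by move=> [|a [|b s]] [|c t].
- by move=> [|a [|b s]] //=.
Qed.

End AlternatingForms.

(** * Insertion of vector valued forms in a frame *)

(** The cancellation that remains in the Jacobi identity once the six twofold
insertions have their coefficients. *)
Lemma addr_cancel_middle (Z : zmodType) (x1 x2 x3 x4 x5 x6 : Z) :
  x1 - x2 + (x3 - x4) + (x2 - x5 + (x4 - x6)) = x1 - x6 + (x3 - x5).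
Proof.
rewrite addrACA [x1 - x2 + _]addrA subrK [x3 - x4 + _]addrA subrK.
by rewrite addrACA [- x5 - x6]addrC addrACA.
Qed.

Section Contraction.
Context {R : comUnitRingType} {V : lmodType R} {m : nat}.
Implicit Types (e : 'I_m -> V) (theta : 'I_m -> {linear V -> R^o}).
Implicit Types (K L : seq V -> V) (k l a b c : int).

(** The insertion i(K) w = sum of K^i /\ i_{e_i} w, for K^i the components of K;
on tangent spaces this is [insertion_at]. *)
Definition frame_insertion e theta (W : lmodType R) K (w : seq V -> W) : seq V -> W :=
  \sum_i wedge (theta i \o K) (iprod (e i) w).

Definition trace_form e theta K : seq V -> R^o :=
  \sum_i iprod (e i) (theta i \o K).

Definition dual_frame e theta : Prop :=
  (forall v, v = \sum_i (theta i v : R) *: e i) /\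
  forall i j, theta i (e j) = (i == j)%:R.

Section FixedFrame.
Variables (e : 'I_m -> V) (theta : 'I_m -> {linear V -> R^o}).
Local Notation D := (frame_insertion e theta).
Local Notation tr := (trace_form e theta).

Lemma insertion_linear_l (W : lmodType R) (w : seq V -> W) :
  linear ((fun K => D K w) : (seq V -> V) -> (seq V -> W)).
Proof.
move=> r K L; rewrite /frame_insertion scaler_sumr -big_split /=.
apply: eq_bigr => i _; rewrite -linearPl /=; congr (wedge _ _).
by apply/funext => s /=; rewrite !add_funE !scale_funE linearP.
Qed.

Lemma insertion_linear_r (W : lmodType R) K :
  linear (D K : (seq V -> W) -> (seq V -> W)).
Proof.
move=> r w w'; rewrite /frame_insertion scaler_sumr -big_split /=.
by apply: eq_bigr => i _; rewrite linearP linearPr.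
Qed.

Lemma insertion_bilinear (W : lmodType R) : bilinear_for
  (GRing.Scale.Law.clone R (seq V -> W) *:%R _)
  (GRing.Scale.Law.clone R (seq V -> W) *:%R _)
  (@frame_insertion e theta W).
Proof. by split=> [g|f]; [exact: insertion_linear_l|exact: insertion_linear_r]. Qed.

HB.instance Definition _ (W : lmodType R) := bilinear_isBilinear.Build R
  (seq V -> V : lmodType R) (seq V -> W : lmodType R) (seq V -> W : zmodType)
  _ _ (@frame_insertion e theta W) (insertion_bilinear W).

Lemma comp_wedge (W W' : lmodType R) (h : {linear W -> W'}) (f : seq V -> R^o)
    (g : seq V -> W) : h \o wedge f g = wedge f (h \o g).
Proof.
apply/funext => s; rewrite /wedge /= linear_sum.
apply: eq_bigr => b _; rewrite linearZ; congr (_ *: _); exact: linearZ.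
Qed.

Lemma comp_insertion (W W' : lmodType R) (h : {linear W -> W'}) K (w : seq V -> W) :
  h \o D K w = D K (h \o w).
Proof.
rewrite /frame_insertion; apply/funext => s.
rewrite /= !fct_sumE linear_sum; apply: eq_bigr => i _.
by rewrite -[LHS]/((h \o wedge _ _) s) comp_wedge.
Qed.

Lemma alt_form_insertion (W : lmodType R) k l K (w : seq V -> W) :
  alt_form k K -> alt_form l w -> alt_form (k + l - 1) (D K w).
Proof.
move=> Kk wl; apply: alt_form_sum => i; rewrite -addrA.
by apply: alt_form_wedge; [exact: alt_form_comp | exact: alt_form_iprod].
Qed.

(** The part of i(K) i(L) w in which both interior products act on w, up to the
grading sign of L: the difference between i(K) i(L) w and i(i(K) L) w. *)
Definition double_insertion (W : lmodType R) K L (w : seq V -> W) : seq V -> W :=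
  \sum_i \sum_j wedge (theta i \o K) (wedge (theta j \o L) (iprod (e i) (iprod (e j) w))).

Lemma grade_sign_comp (W W' : lmodType R) (h : {linear W -> W'}) (g : seq V -> W) :
  grade_sign (h \o g) = h \o grade_sign g.
Proof. by apply/funext => s; rewrite /grade_sign /= linearZ. Qed.

(** As i_{e_i} is a graded derivation, i(K) i(L) w consists of the terms where
it hits the components of L, which add up to i(i(K) L) w, and the terms where it
hits w. The sign of the second kind of term is carried by the
grading involution. *)
Lemma insertion_insertion (W : lmodType R) K L (w : seq V -> W) :
  D K (D L w) = D (D K L) w + double_insertion K (grade_sign L) w.
Proof.
rewrite /double_insertion [LHS]/frame_insertion.
transitivity (\sum_i \sum_j wedge (wedge (theta i \o K) (iprod (e i) (theta j \o L)))
                             (iprod (e j) w) +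
  \sum_i \sum_j wedge (theta i \o K)
    (wedge (theta j \o grade_sign L) (iprod (e i) (iprod (e j) w)))).
  rewrite -big_split; apply: eq_bigr => i _ /=.
  rewrite -big_split /= linear_sum /= linear_sumr /=; apply: eq_bigr => j _.
  by rewrite iprod_wedge linearDr /= wedgeA grade_sign_comp.
congr (_ + _); rewrite exchange_big /=; apply: eq_bigr => j _.
by rewrite -linear_sumlz /= comp_insertion.
Qed.

(** Exchanging K and L moves the components of K past those of L and exchanges
the two interior products. *)
Lemma double_insertion_sym (W : lmodType R) k l K L (w : seq V -> W) :
  homogeneous k K -> homogeneous l L -> multilinear w -> Defs.alternating w ->
  double_insertion K L w = - (-1) ^ (k * l) *: double_insertion L K w.
Proof.
move=> Kk Ll wm wa; rewrite /double_insertion exchange_big scaler_sumr /=.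
apply: eq_bigr => j _; rewrite scaler_sumr; apply: eq_bigr => i _.
rewrite -!wedgeA iprod_anticomm // linearNr /= scaleNr; congr (- _).
rewrite (@wedgeC _ _ k l) ?linearZl //.
- by move=> s sk /=; rewrite Kk ?linear0.
- by move=> s sk /=; rewrite Ll ?linear0.
Qed.

(** The Nijenhuis-Richardson bracket in the shifted grading: K and L are forms
of degrees a + 1 and b + 1. *)
Definition nr_bracket a b K L := D K L - (-1) ^ (a * b) *: D L K.

(** The insertion represents the bracket by the graded commutator, since the
terms where both insertions act on w cancel by [double_insertion_sym]. *)
Lemma insertion_bracket (W : lmodType R) a b K L (w : seq V -> W) :
  homogeneous (a + 1) K -> homogeneous (b + 1) L ->
  multilinear w -> Defs.alternating w ->
  D (nr_bracket a b K L) w = D K (D L w) - (-1) ^ (a * b) *: D L (D K w).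
Proof.
move=> Ka Lb wm wa; rewrite /nr_bracket linearBl linearZl /= !insertion_insertion.
rewrite scalerDr opprD addrACA -[LHS]addr0; congr (_ + _).
rewrite (grade_sign_homogeneous Ka) (grade_sign_homogeneous Lb).
rewrite (@double_insertion_sym _ (a + 1) (b + 1)) //; last exact: homogeneous_scale.
have dZ r K' L' : double_insertion (r *: K') L' w = r *: double_insertion K' L' w.
  rewrite /double_insertion scaler_sumr; apply: eq_bigr => i _.
  rewrite scaler_sumr; apply: eq_bigr => j _.
  rewrite -linearZl /=; congr (wedge _ _).
  by apply/funext => s; rewrite /= !scale_funE linearZ.
have dZr r K' L' : double_insertion K' (r *: L') w = r *: double_insertion K' L' w.
  rewrite /double_insertion scaler_sumr; apply: eq_bigr => i _.
  rewrite scaler_sumr; apply: eq_bigr => j _.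
  rewrite -linearZr /= -linearZl /=; congr (wedge _ (wedge _ _)).
  by apply/funext => s; rewrite /= !scale_funE linearZ.
rewrite dZ dZr !scalerA -scalerBl (_ : _ - _ = 0) ?scale0r //.
rewrite (_ : (a + 1) * (b + 1) = a * b + a + b + 1) ?signzE; last by ring.
by case: (signz_cases R a) => ->; case: (signz_cases R b) => ->; rewrite ?signzE; ring.
Qed.

(** By [insertion_bracket] both sides become combinations of twofold insertions
such as i(K) i(L) N, with coefficients that are products of the three signs
(-1) ^ (a * b), (-1) ^ (a * c) and (-1) ^ (b * c). *)
Lemma nr_bracket_jacobi a b c K L N :
  alt_form (a + 1) K -> alt_form (b + 1) L -> alt_form (c + 1) N ->
  nr_bracket a (b + c) K (nr_bracket b c L N) =
  nr_bracket (a + b) c (nr_bracket a b K L) N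
  + (-1) ^ (a * b) *: nr_bracket b (a + c) L (nr_bracket a c K N).
Proof.
move=> [Km Ka Kh] [Lm La Lh] [Nm Na Nh].
rewrite [LHS]/nr_bracket [nr_bracket (a + b) _ _ _]/nr_bracket.
rewrite [nr_bracket b (a + c) _ _]/nr_bracket !insertion_bracket //.
rewrite /nr_bracket !(linearBr, linearBl) !(linearZr, linearZl) /=.
rewrite !scalerBr !scalerA !opprB.
rewrite !(mulrDl, mulrDr) [b * a]mulrC !signzD.
move: (signzz R (a * b)); set p := _ ^ (a * b); set q := _ ^ (a * c).
set r := _ ^ (b * c) => pp; rewrite !mulrA pp mul1r [r * q]mulrC [q * r * p]mulrC mulrA.
by rewrite addr_cancel_middle.
Qed.

Lemma nr_bracket_linear_l a b r K K' L :
  nr_bracket a b (r *: K + K') L = r *: nr_bracket a b K L + nr_bracket a b K' L.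
Proof.
rewrite /nr_bracket linearPl linearPr /= scalerDr scalerBr !scalerA [r * _]mulrC.
by rewrite opprD addrACA.
Qed.

Lemma nr_bracket_antisym a b K L :
  nr_bracket a b K L = - ((-1) ^ (a * b) *: nr_bracket b a L K).
Proof.
by rewrite /nr_bracket scalerBr scalerA [b * a]mulrC signzz scale1r opprB.
Qed.

Lemma nr_bracket_linear_r a b r K L L' :
  nr_bracket a b K (r *: L + L') = r *: nr_bracket a b K L + nr_bracket a b K L'.
Proof.
rewrite ![nr_bracket a b K _]nr_bracket_antisym nr_bracket_linear_l.
by rewrite scalerDr opprD scalerN !scalerA [r * _]mulrC.
Qed.

Lemma trace_form_linear : linear (tr : (seq V -> V) -> (seq V -> R^o)).
Proof.
move=> r K L; rewrite /trace_form scaler_sumr -big_split /=.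
by apply: eq_bigr => i _; apply/funext => s; rewrite /iprod /= linearP.
Qed.

HB.instance Definition _ := GRing.isLinear.Build R (seq V -> V) (seq V -> R^o)
  *:%R tr trace_form_linear.

(** The trace of i(K) L is a graded symmetric expression in K and L, up to the
terms where both interior products hit the same component of L; these add up, up
to sign, to the insertion of K in the trace of L. *)
Lemma trace_insertion a b K L :
  alt_form (a + 1) K -> alt_form (b + 1) L -> tr L = 0 ->
  tr (D K L) =
    \sum_i \sum_j wedge (iprod (e j) (theta i \o K)) (iprod (e i) (theta j \o L)).
Proof.
move=> Ka Lb trL; rewrite exchange_big.
transitivity (\sum_j \sum_i
   wedge (iprod (e j) (theta i \o K)) (iprod (e i) (theta j \o L)) +
   \sum_j \sum_i wedge (grade_sign (theta i \o K))
     (iprod (e j) (iprod (e i) (theta j \o L)))).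
  rewrite -big_split; apply: eq_bigr => j _; rewrite /= -big_split /=.
  rewrite comp_insertion linear_sum; apply: eq_bigr => i _.
  by rewrite /= iprod_wedge.
rewrite -[RHS]addr0; congr (_ + _); rewrite exchange_big big1 //= => i _.
rewrite -linear_sumr /= (_ : \sum_j _ = - iprod (e i) (tr L)).
  by rewrite trL linear0 linear0r.
rewrite linear_sum -sumrN /=; apply: eq_bigr => j _.
by case: (alt_form_comp (theta j) Lb) => ? ? _; rewrite iprod_anticomm.
Qed.

Lemma trace_bracket a b K L :
  alt_form (a + 1) K -> alt_form (b + 1) L -> tr K = 0 -> tr L = 0 ->
  tr (nr_bracket a b K L) = 0.
Proof.
move=> Ka Lb trK trL; rewrite linearB linearZ /=.
rewrite (trace_insertion Ka Lb trL) (trace_insertion Lb Ka trK).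
rewrite [X in _ *: X]exchange_big scaler_sumr -sumrB big1 // => i _.
rewrite scaler_sumr -sumrB big1 // => j _.
have [_ _ hK] := alt_form_iprod (e j) (alt_form_comp (theta i) Ka).
have [_ _ hL] := alt_form_iprod (e i) (alt_form_comp (theta j) Lb).
rewrite addrK in hK; rewrite addrK in hL.
by rewrite (wedgeC hK hL) subrr.
Qed.

Hypothesis frameP : dual_frame e theta.

Lemma iprod_frame (W : lmodType R) (w : seq V -> W) v : multilinear w ->
  \sum_i (theta i v : R) *: iprod (e i) w = iprod v w.
Proof.
move=> wm; have lin := iprod_linear_vector wm.
pose h : {linear V -> (seq V -> W)} := HB.pack (fun v => iprod v w)
  (GRing.isLinear.Build R V (seq V -> W) *:%R (fun v => iprod v w) lin).
rewrite -[RHS]/(h v) {2}(frameP.1 v) linear_sum; apply: eq_bigr => i _.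
by rewrite linearZ.
Qed.

(** Summing over the frame puts the value of K back into the first argument of
w. The right hand side does not mention the frame, so all frames give the same
insertion. *)
Lemma frame_insertionE (W : lmodType R) K (w : seq V -> W) s : multilinear w ->
  D K w s = \sum_(b : (size s).-tuple bool) (-1) ^+ shuffle_inversions b *:
    w (K (mask b s) :: mask [seq ~~ x | x <- b] s).
Proof.
move=> wm; rewrite /frame_insertion fct_sumE /wedge exchange_big /=.
apply: eq_bigr => b _; rewrite -scaler_sumr; congr (_ *: _).
rewrite -[RHS]/(iprod (K (mask b s)) w (mask [seq ~~ x | x <- b] s)).
by rewrite -(iprod_frame _ wm) fct_sumE.
Qed.

Local Notation id_V := (@identity_form R V).

Lemma comp_identity (h : {linear V -> R^o}) v :
  iprod v (h \o id_V) = (h v : R) *: unit_form.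
Proof.
apply/funext => -[|u s]; rewrite scale_funE /iprod /=; first by rewrite [RHS]mulr1.
by rewrite scaler0 linear0.
Qed.

Lemma homogeneous_comp_identity (h : {linear V -> R^o}) : homogeneous 1 (h \o id_V).
Proof. by have [] := alt_form_comp h alt_form_identity. Qed.

(** In i_v i(I) w the terms where i_v hits a coframe element add up to i_v w by
[iprod_frame], and the others to i(I) i_v w; so the value at s grows by one copy
of w s with each argument. *)
Lemma insertion_identity (W : lmodType R) k (w : seq V -> W) : alt_form k w ->
  D id_V w = k%:~R *: w.
Proof.
move=> [wm wa wk]; apply/funext => s; rewrite scale_funE.
transitivity ((size s)%:R *: w s); last first.
  have [<-//|/eqP sk] := eqVneq (size s)%:Z k.
  by rewrite wk ?scaler0.
elim: s w wm wa {wk} => [|v s IHs] w wm wa.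
  rewrite scale0r /frame_insertion fct_sumE big1 // => i _.
  by rewrite wedge_nil /= linear0 scale0r.
rewrite /frame_insertion -[LHS]/(iprod v _ s) linear_sum.
transitivity ((\sum_i (theta i v : R) *: iprod (e i) w + D id_V (iprod v w)) s).
  rewrite -big_split; congr (_ s); apply: eq_bigr => i _ /=.
  rewrite iprod_wedge comp_identity linearZl /= wedge1l; congr (_ + _).
  rewrite (grade_sign_homogeneous (@homogeneous_comp_identity _)) expr1z.
  by rewrite linearZl /= iprod_anticomm // linearNr /= scaleN1r opprK.
rewrite add_funE (iprod_frame _ wm) IHs; last exact: alternating_iprod.
  by rewrite -[iprod v w s]/(w (v :: s)) /= -{1}[w _]scale1r -scalerDl -mulrS.
exact: multilinear_iprod.
Qed.

Lemma insertion_wedge_identity (W : lmodType R) k (f : seq V -> R^o) (w : seq V -> W) :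
  alt_form k w -> D (wedge f id_V) w = k%:~R *: wedge f w.
Proof.
move=> wk; rewrite -linearZr /= -(insertion_identity wk) /frame_insertion linear_sumr /=.
by apply: eq_bigr => i _; rewrite comp_wedge wedgeA.
Qed.

Lemma wedge_idE (f : seq V -> R^o) :
  \sum_i tensor_vec (wedge f (linear_form (theta i))) (e i) = wedge f id_V.
Proof.
have thE i : linear_form (theta i) = theta i \o id_V.
  by apply/funext => -[|u [|? ?]] /=; rewrite ?linear0.
apply/funext => s; rewrite fct_sumE [RHS](frameP.1 _).
by apply: eq_bigr => i _; rewrite /tensor_vec thE -comp_wedge.
Qed.

(** The two terms of i_{e_i}(f /\ theta^i) sum to (-1) ^ (k - 1) times the
insertion of the identity into f, and to (-1) ^ k times m copies of f. For
k <> m the trace thus recovers f from f /\ I. *)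
Lemma trace_wedge_identity k (f : seq V -> R^o) : alt_form k f ->
  tr (wedge f id_V) = ((-1) ^ k * (m%:~R - k%:~R)) *: f.
Proof.
move=> fk; have [fm fa fh] := fk.
transitivity (\sum_i (wedge (iprod (e i) f) (theta i \o id_V) + (-1) ^ k *: f)).
  apply: eq_bigr => i _; rewrite comp_wedge iprod_wedge; congr (_ + _).
  rewrite comp_identity (frameP.2 i i) eqxx scale1r.
  by rewrite (grade_sign_homogeneous fh) linearZl /= (wedge1r fh).
rewrite big_split sumr_const card_ord /= mulrBr scalerBl addrC; congr (_ + _).
  by rewrite -scaler_nat scalerA mulrC.
rewrite -scalerA -(insertion_identity fk) -scaleNr /frame_insertion scaler_sumr.
apply: eq_bigr => i _.
rewrite (wedgeC (@homogeneous_iprod _ _ _ (e i) _ _ fh) (@homogeneous_comp_identity (theta i))).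
by rewrite mulr1 signzD signzN expr1z mulrN1.
Qed.

End FixedFrame.
End Contraction.

(** * Smooth functions on open sets *)

Import numFieldNormedType.Exports.

Section SmoothFunctions.
Local Open Scope classical_set_scope.
Context {R : realType} {V : normedModType R}.
Implicit Types (U : set V) (f g : V -> R^o).

Lemma near_eq_on U f g x : open U -> {in U, f =1 g} -> U x -> \forall y \near x, f y = g y.
Proof.
move=> Uo fg Ux; apply: filterS (open_nbhs_nbhs (conj Uo Ux)) => y Uy.
by apply: fg; rewrite inE.
Qed.

(** The differential of f is also a first order approximation of g. *)
Lemma near_eq_differentiable f g x : (\forall y \near x, f y = g y) ->
  differentiable f x -> differentiable g x.
Proof.
move=> fg df; have dfc := diff_continuous df.
have fgx : f x = g x := nbhs_singleton fg.
have dg : g \o shift x = cst (g x) + 'd f x +o_ 0 id.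
  apply/eqaddoP => eps eps0.
  have /eqaddoP/(_ eps eps0) := diff_locally df.
  have : \forall h \near 0, f (h + x) = g (h + x).
    by move: fg; rewrite (near_shift 0) subr0.
  apply: filterS2 => h fgh; rewrite -fgx.
  by rewrite -[X in _ -> `|X| <= _]/(g (h + x) - _) -fgh.
by apply/diff_locallyP; rewrite (diff_unique dfc dg).
Qed.

Lemma iter_derive_eq U (vs : seq V) f g : open U -> {in U, f =1 g} ->
  {in U, iter_derive vs f =1 iter_derive vs g}.
Proof.
move=> Uo; elim: vs => [|v vs IHvs] //= fg x /[!inE] Ux.
by apply: near_eq_derive; exact: near_eq_on (IHvs fg) Ux.
Qed.

Lemma smooth_on_eq U f g : open U -> {in U, f =1 g} -> smooth_on U f -> smooth_on U g.
Proof.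
move=> Uo fg fs vs x Ux; have fgvs := iter_derive_eq vs Uo fg.
exact: near_eq_differentiable (near_eq_on Uo fgvs Ux) (fs vs x Ux).
Qed.

Lemma smooth_on_differentiable U f x : smooth_on U f -> U x -> differentiable f x.
Proof. by move=> fs; exact: fs [::] x. Qed.

Lemma smooth_on_derive U f v : smooth_on U f -> smooth_on U (fun x => 'D_v f x : R^o).
Proof. by move=> fs vs x Ux; have := fs (rcons vs v) x Ux; rewrite /iter_derive foldr_rcons. Qed.

(** A coinduction principle: a class of differentiable functions which is closed
under directional derivatives, up to equality on U, consists of smooth
functions. *)
Lemma smooth_on_coind U (P : (V -> R^o) -> Prop) : open U ->
  (forall f, P f -> forall x, U x -> differentiable f x) ->
  (forall f v, P f -> exists2 g, P g & {in U, g =1 (fun x => 'D_v f x : R^o)}) ->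
  forall f, P f -> smooth_on U f.
Proof.
move=> Uo Pdiff Pderive f Pf vs; elim/last_ind: vs f Pf => [|vs v IHvs] f Pf x Ux.
  exact: Pdiff.
rewrite /iter_derive foldr_rcons; have [g Pg gf] := Pderive f v Pf.
have gfvs := iter_derive_eq vs Uo gf.
exact: near_eq_differentiable (near_eq_on Uo gfvs Ux) (IHvs g Pg x Ux).
Qed.

Lemma smooth_on_cst U (r : R^o) : open U -> smooth_on U (cst r : V -> R^o).
Proof.
move=> Uo; apply: (@smooth_on_coind _ (fun f => exists r, f = cst r)) => //; last by exists r.
  by move=> _ [q ->] x _.
move=> _ v [q ->]; exists (cst 0); first by exists 0.
by move=> x _; rewrite /= derive_cst.
Qed.

Lemma smooth_onD U f g : open U -> smooth_on U f -> smooth_on U g -> smooth_on U (f + g).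
Proof.
move=> Uo fs gs; apply: (@smooth_on_coind _
    (fun h => exists f g, [/\ smooth_on U f, smooth_on U g & h = f + g])) => //.
- move=> _ [f1 [g1 [f1s g1s ->]]] x Ux.
  by apply: differentiableD; exact: smooth_on_differentiable Ux.
- move=> _ v [f1 [g1 [f1s g1s ->]]].
  exists ((fun x => 'D_v f1 x : R^o) + (fun x => 'D_v g1 x : R^o)).
    by do 2!eexists; split; last reflexivity; exact: smooth_on_derive.
  move=> x; rewrite inE => Ux; rewrite deriveD //;
    exact/diff_derivable/smooth_on_differentiable/Ux.
- by exists f, g.
Qed.

Lemma smooth_on_sum U (I : Type) (r : seq I) (F : I -> V -> R^o) : open U ->
  (forall i, smooth_on U (F i)) -> smooth_on U (fun x => \sum_(i <- r) F i x).
Proof.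
move=> Uo Fs; rewrite (_ : (fun x => _) = \sum_(i <- r) F i); last first.
  by apply/funext => x; rewrite fct_sumE.
elim/big_ind : _ => //; first exact: smooth_on_cst.
by move=> f g; exact: smooth_onD.
Qed.

(** The closure of the products of smooth functions under sums is stable under
derivatives by the Leibniz rule, whereas the products alone are not. *)
Inductive sum_of_products U : (V -> R^o) -> Prop :=
| SumProd f g : smooth_on U f -> smooth_on U g ->
    sum_of_products U ((f : V -> R) * (g : V -> R))
| SumAdd h1 h2 : sum_of_products U h1 -> sum_of_products U h2 ->
    sum_of_products U (h1 + h2).

Lemma sum_of_products_differentiable U h x :
  sum_of_products U h -> U x -> differentiable h x.
Proof.
move=> hP Ux; elim: hP => [f g fs gs|h1 h2 _ dh1 _ dh2]; last exact: differentiableD.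
apply: (@differentiableM _ _ f g); exact: smooth_on_differentiable Ux.
Qed.

Lemma sum_of_products_derive U h v : sum_of_products U h ->
  exists2 h', sum_of_products U h' & {in U, h' =1 (fun x => 'D_v h x : R^o)}.
Proof.
elim=> [f g fs gs|h1 h2 h1P [h1' h1'P h1'E] h2P [h2' h2'P h2'E]].
  exists (((f : V -> R) * (fun x => 'D_v g x : R) : V -> R^o) +
          ((g : V -> R) * (fun x => 'D_v f x : R) : V -> R^o)).
    by apply: SumAdd; apply: SumProd => //; exact: smooth_on_derive.
  move=> x; rewrite inE => Ux; rewrite (@deriveM _ _ f g) //;
    exact/diff_derivable/smooth_on_differentiable/Ux.
exists (h1' + h2'); first exact: SumAdd.
move=> x xU; rewrite add_funE h1'E // h2'E //.
move: xU; rewrite inE => Ux; rewrite deriveD //;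
  exact/diff_derivable/sum_of_products_differentiable/Ux.
Qed.

Lemma smooth_onM U f g : open U -> smooth_on U f -> smooth_on U g ->
  smooth_on U (fun x => (f x : R) * g x : R^o).
Proof.
move=> Uo fs gs; apply: (@smooth_on_coind _ (sum_of_products U)) => //.
- by move=> h hP x; exact: sum_of_products_differentiable.
- by move=> h v; exact: sum_of_products_derive.
- exact: SumProd.
Qed.

End SmoothFunctions.

(** * Coordinate frames of the tangent spaces *)

Section CoordinateFrames.
Local Open Scope classical_set_scope.
Context {R : realType} {m : nat} (M : smooth_manifold R m).
Implicit Types (x : M) (a : chart_index M).

(** Near the point the coordinate change from a chart to itself is the
identity. *)
Lemma transition_jacobian_id a x : chart_dom a x -> transition_jacobian a a x = 1%:M.
Proof.
move=> ax; apply/row_matrixP => i; rewrite !rowE mul_transition_jacobian // mulmx1.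
have near_id : \forall y \near chart_coord a x, (chart_coord a \o chart_inv a) y = id y.
  have imgx : (chart_coord a @` chart_dom a) (chart_coord a x) by exists x.
  have := open_nbhs_nbhs (conj (@open_chart_image _ _ M a) imgx).
  by apply: filterS => _ [z az <-] /=; rewrite coordK.
by rewrite (near_eq_derive _ near_id) derive_id.
Qed.

Lemma dcoord_linear a i x : linear (@dcoord _ _ M a i x : tangent x -> R^o).
Proof.
move=> r u v; rewrite /dcoord; case: pselect => [ax|_]; last by rewrite scaler0 addr0.
have -> : components (r *: u + v) = r *: components u + components v.
  exact: (linearP (val : tangent x -> _)).
by rewrite add_funE scale_funE !mxE.
Qed.

HB.instance Definition _ a i x := GRing.isLinear.Build R (tangent x) R^o *:%R
  (@dcoord _ _ M a i x) (@dcoord_linear a i x).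

Definition coordinate_vectors a x : 'I_m -> tangent x := fun i => coord_vector a i x.

Definition coordinate_covectors a x : 'I_m -> {linear tangent x -> R^o} :=
  fun i => @dcoord _ _ M a i x.

Arguments coordinate_vectors a x i : clear implicits.
Arguments coordinate_covectors a {x} i.

Lemma coordinate_frame a x : chart_dom a x ->
  dual_frame (coordinate_vectors a x) (@coordinate_covectors a x).
Proof.
move=> ax; rewrite /coordinate_vectors /coordinate_covectors; split.
  move=> v; apply: val_inj; rewrite (linear_sum (val : tangent x -> _)) /= /dcoord /coord_vector.
  case: pselect => // ax'; apply/funext => q; rewrite fct_sumE.
  have /asboolP /(_ (exist _ a ax') q) -> := tangentP v.
  rewrite {1}(row_sum_delta (components v (exist _ a ax'))) mulmx_suml.
  by apply: eq_bigr => i _; rewrite -scalemxAl.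
move=> i j /=; rewrite /dcoord /coord_vector; case: pselect => // ax'.
by rewrite /= transition_jacobian_id // mulmx1 mxE eqxx eq_sym.
Qed.

End CoordinateFrames.
Arguments coordinate_vectors {R m M} a x i.
Arguments coordinate_covectors {R m M} a {x} i.

(** * Smoothness of the operations on forms *)

Section SmoothForms.
Local Open Scope classical_set_scope.
Context {R : realType} {m : nat} (M : smooth_manifold R m).
Implicit Types (x : M) (a : chart_index M) (F G : forall x, seq (tangent x) -> R^o).

(** Smoothness of the coefficients in one chart, for a family that need not be
alternating; exterior products and components of vector valued forms can then be
treated on the same footing. *)
Definition smooth_coefs a F : Prop := forall js : seq 'I_m,
  smooth_on (chart_coord a @` chart_dom a)
    (fun y => F (chart_inv a y) [seq coord_vector a j (chart_inv a y) | j <- js]).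

Lemma chart_image_inv a y : (chart_coord a @` chart_dom a) y -> chart_dom a (chart_inv a y).
Proof. by move=> [x ax <-]; rewrite coordK. Qed.

Lemma smooth_coefs_eq a F G : (forall x, chart_dom a x -> F x = G x) ->
  smooth_coefs a F -> smooth_coefs a G.
Proof.
move=> FG Fs js; apply: smooth_on_eq (Fs js); first exact: open_chart_image.
by move=> y; rewrite inE => /chart_image_inv /FG ->.
Qed.

Lemma smooth_coefs_linear_comb a r F G : smooth_coefs a F -> smooth_coefs a G ->
  smooth_coefs a (fun x => r *: F x + G x).
Proof.
move=> Fs Gs js; have Uo := @open_chart_image _ _ M a.
exact: smooth_onD Uo (smooth_onM Uo (smooth_on_cst r Uo) (Fs js)) (Gs js).
Qed.

Lemma smooth_coefs_iprod a j F : smooth_coefs a F ->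
  smooth_coefs a (fun x => iprod (coord_vector a j x) (F x)).
Proof. by move=> Fs js; exact: Fs (j :: js). Qed.

Lemma smooth_coefs_sum a I (r : seq I) (F : I -> forall x, seq (tangent x) -> R^o) :
  (forall i, smooth_coefs a (F i)) -> smooth_coefs a (fun x => \sum_(i <- r) F i x).
Proof.
move=> Fs js; under eq_fun do rewrite fct_sumE.
by apply: smooth_on_sum => [|i]; [exact: open_chart_image | exact: Fs].
Qed.

Lemma smooth_coefs_wedge a F G : smooth_coefs a F -> smooth_coefs a G ->
  smooth_coefs a (fun x => wedge (F x) (G x)).
Proof.
move=> Fs Gs js; have Uo := @open_chart_image _ _ M a.
under eq_fun do rewrite (wedge_size _ _ (size_map _ _)).
apply: smooth_on_sum => // b; under eq_fun do rewrite -!map_mask.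
apply: (smooth_onM Uo (smooth_on_cst _ Uo)).
exact: (smooth_onM Uo (Fs _) (Gs _)).
Qed.

Lemma smooth_coefs_identity a i :
  smooth_coefs a (fun x => coordinate_covectors a i \o @identity_form R (tangent x)).
Proof.
move=> js; have Uo := @open_chart_image _ _ M a.
case: js => [|j [|j' js]]; rewrite /comp /=.
- by apply: smooth_on_eq (smooth_on_cst 0 Uo) => // y _; rewrite linear0.
- apply: smooth_on_eq (smooth_on_cst (i == j)%:R Uo) => // y; rewrite inE => ay.
  by rewrite (coordinate_frame (chart_image_inv ay)).2.
- by apply: smooth_on_eq (smooth_on_cst 0 Uo) => // y _; rewrite linear0.
Qed.

Lemma smooth_vformE (K : vform M) : smooth_vform K <->
  forall a i, smooth_coefs a (fun x => coordinate_covectors a i \o K x).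
Proof. by []. Qed.

Lemma chart_atP x : chart_dom (chart_at x) x.
Proof. by rewrite /chart_at; case: cid. Qed.

Definition frame_at x := coordinate_frame (chart_atP x).

(** The insertion is defined with the frame of a chart chosen at each point,
which varies with the point; smoothness has to be read off in a fixed chart. *)
Lemma insertion_at_chart a x (W : lmodType R) (K : vform M) (w : seq (tangent x) -> W) :
  chart_dom a x -> multilinear w ->
  insertion_at K w = frame_insertion (coordinate_vectors a x) (coordinate_covectors a) (K x) w.
Proof.
move=> ax wm; apply/funext => s.
rewrite (frame_insertionE (coordinate_frame ax)) //.
exact: (frame_insertionE (frame_at x) (K x) s wm).
Qed.

Lemma Omega_alt k w x : Omega M k w -> alt_form k (w x).
Proof. by move=> [/(_ x)]. Qed.

Lemma vOmega_alt k K x : vOmega M k K -> alt_form k (K x).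
Proof. by move=> [/(_ x)]. Qed.

Lemma Omega0 k : Omega M k 0.
Proof.
split=> [x|a js]; first exact: alt_form0.
by apply: smooth_on_cst; exact: open_chart_image.
Qed.

Lemma Omega_linear_comb k r w w' : Omega M k w -> Omega M k w' -> Omega M k (r *: w + w').
Proof.
move=> [wk ws] [w'k w's]; split=> [x|a]; first exact: alt_form_linear_comb.
exact: smooth_coefs_linear_comb.
Qed.

Lemma vOmega0 k : vOmega M k 0.
Proof.
split=> [x|a i js]; first exact: alt_form0.
have Uo := @open_chart_image _ _ M a.
apply: smooth_on_eq Uo _ (smooth_on_cst 0 Uo) => y _.
by apply/esym; exact: (linear0 (coordinate_covectors a i)).
Qed.

Lemma vOmega_linear_comb k r K L : vOmega M k K -> vOmega M k L -> vOmega M k (r *: K + L).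
Proof.
move=> [Kk Ks] [Lk Ls]; split=> [x|]; first exact: alt_form_linear_comb.
apply/smooth_vformE => a i; apply: smooth_coefs_eq (smooth_coefs_linear_comb r (Ks a i) (Ls a i)).
by move=> x _; apply/funext => s; apply/esym; exact: (linearP (coordinate_covectors a i)).
Qed.

Lemma Omega_wedge k l f g : Omega M k f -> Omega M l g -> Omega M (k + l) (form_wedge f g).
Proof.
move=> [fk fs] [gl gs]; split=> [x|a]; first exact: alt_form_wedge.
exact: smooth_coefs_wedge.
Qed.

Lemma vOmega_vinsertion k l K L : vOmega M k K -> vOmega M l L ->
  vOmega M (k + l - 1) (vinsertion K L).
Proof.
move=> [Kk Ks] [Ll Ls]; split=> [x|]; first exact: alt_form_insertion.
apply/smooth_vformE => a j.
apply: (@smooth_coefs_eq _ (fun x => \sum_i wedge (coordinate_covectors a i \o K x)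
    (iprod (coord_vector a i x) (coordinate_covectors a j \o L x)))) => [x ax|].
  have [Lm _ _] := Ll x.
  by rewrite /vinsertion (insertion_at_chart _ ax Lm) comp_insertion.
apply: smooth_coefs_sum => i; apply: smooth_coefs_wedge; first exact: Ks.
exact/smooth_coefs_iprod/Ls.
Qed.

(** f /\ I is the exterior product of f with the identity taken as a vector
valued form, which frees it from the coordinate frame. *)
Lemma wedge_idTME (f : dform M) : wedge_idTM f = fun x => wedge (f x) identity_form.
Proof.
apply: functional_extensionality_dep => x; rewrite /wedge_idTM.
exact: wedge_idE (frame_at x) _.
Qed.

Lemma vOmega_wedge_idTM k f : Omega M k f -> vOmega M (k + 1) (wedge_idTM f).
Proof.
move=> [fk fs]; rewrite wedge_idTME; split=> [x|].
  by apply: alt_form_wedge => //; exact: alt_form_identity.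
apply/smooth_vformE => a i.
apply: (@smooth_coefs_eq a
    (fun x => wedge (f x) (coordinate_covectors a i \o identity_form))) => [x _|].
  by rewrite -comp_wedge.
by apply: smooth_coefs_wedge; [exact: fs | exact: smooth_coefs_identity].
Qed.

End SmoothForms.

(** * The graded Lie algebras of forms *)

Section GradedLieAlgebras.
Local Open Scope classical_set_scope.
Context {R : realType} {m : nat} (M : smooth_manifold R m).
Implicit Types x : M.

Lemma NR_bracketE (a b : int) (K L : vform M) x : NR_bracket (a + 1) (b + 1) K L x =
  nr_bracket (coordinate_vectors (chart_at x) x) (coordinate_covectors (chart_at x))
    a b (K x) (L x).
Proof. by rewrite /NR_bracket !addrK. Qed.

Lemma vOmega_NR_bracket (a b : int) K L : vOmega M (a + 1) K -> vOmega M (b + 1) L ->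
  vOmega M (a + b + 1) (NR_bracket (a + 1) (b + 1) K L).
Proof.
move=> Ka Lb; rewrite /NR_bracket [X in vOmega _ _ X]addrC -scaleNr; apply: vOmega_linear_comb.
  rewrite (_ : a + b + 1 = b + 1 + (a + 1) - 1); last by ring.
  exact: vOmega_vinsertion.
rewrite (_ : a + b + 1 = a + 1 + (b + 1) - 1); last by ring.
exact: vOmega_vinsertion.
Qed.

(** Beyond closure, which involves smoothness, the axioms are identities that
hold at each point in the frame of the chart chosen there. *)
Lemma NR_bracket_graded_lie : graded_lie_algebra (fun a : int => vOmega M (a + 1))
  (fun a b => NR_bracket (a + 1) (b + 1)).
Proof.
split.
- by move=> a; split=> [|r K L]; [exact: vOmega0 | exact: vOmega_linear_comb].
- exact: vOmega_NR_bracket.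
- move=> a b r K K' L _ _ _; apply: functional_extensionality_dep => x.
  rewrite NR_bracketE nr_bracket_linear_l.
  by rewrite -!NR_bracketE.
- move=> a b r K L L' _ _ _; apply: functional_extensionality_dep => x.
  rewrite NR_bracketE nr_bracket_linear_r.
  by rewrite -!NR_bracketE.
- move=> a b K L _ _; apply: functional_extensionality_dep => x.
  rewrite NR_bracketE nr_bracket_antisym.
  by rewrite -!NR_bracketE.
- move=> a b c K L N Ka Lb Nc; apply: functional_extensionality_dep => x.
  rewrite NR_bracketE NR_bracketE.
  rewrite (nr_bracket_jacobi _ _ (vOmega_alt x Ka) (vOmega_alt x Lb) (vOmega_alt x Nc)).
  by rewrite -!NR_bracketE.
Qed.

Lemma contraction_formE (K : vform M) x : @contraction_form _ _ M K x =
  trace_form (coordinate_vectors (chart_at x) x) (coordinate_covectors (chart_at x)) (K x).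
Proof. by []. Qed.

Lemma trace_free_graded_lie : graded_lie_subalgebra (fun a : int => vOmega M (a + 1))
  (fun a b => NR_bracket (a + 1) (b + 1)) (fun a => trace_free M (a + 1)).
Proof.
split; first exact: NR_bracket_graded_lie.
- by move=> a K [].
- move=> a; split.
    split; first exact: vOmega0.
    apply: functional_extensionality_dep => x; rewrite contraction_formE.
    exact: (linear0 (trace_form _ _)).
  move=> r K L [Ka trK] [La trL]; split; first exact: vOmega_linear_comb.
  apply: functional_extensionality_dep => x; 
  transitivity (r *: @contraction_form _ _ M K x + @contraction_form _ _ M L x).
    exact: (linearP (trace_form _ _)).
  by rewrite trK trL [LHS]addr0 [LHS]scaler0.
- move=> a b K L [Ka trK] [Lb trL]; split; first exact: vOmega_NR_bracket.
  apply: functional_extensionality_dep => x; rewrite contraction_formE NR_bracketE.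
  apply: (trace_bracket (vOmega_alt x Ka) (vOmega_alt x Lb)).
    by rewrite -contraction_formE trK.
  by rewrite -contraction_formE trL.
Qed.

Lemma wedge_idTM_linear r (f g : dform M) :
  wedge_idTM (r *: f + g) = r *: wedge_idTM f + wedge_idTM g.
Proof.
rewrite !wedge_idTME; apply: functional_extensionality_dep => x.
by rewrite [LHS]linearPl.
Qed.

(** i(f /\ I) multiplies by the degree and by f, so the bracket is
((l + 1) - (k + 1)) times f /\ g /\ I once g /\ f is reordered. *)
Lemma wedge_idTM_bracket (k l : int) f g : Omega M k f -> Omega M l g ->
  NR_bracket (k + 1) (l + 1) (wedge_idTM f) (wedge_idTM g) = wedge_idTM (form_bracket k l f g).
Proof.
move=> fk gl; apply: functional_extensionality_dep => x; rewrite NR_bracketE !wedge_idTME.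
have fx := Omega_alt x fk; have gx := Omega_alt x gl.
have idx := @alt_form_identity R (tangent x).
rewrite /nr_bracket (insertion_wedge_identity (frame_at x) _ (alt_form_wedge gx idx)).
rewrite (insertion_wedge_identity (frame_at x) _ (alt_form_wedge fx idx)) -!wedgeA.
have [_ _ fh] := fx; have [_ _ gh] := gx.
rewrite (wedgeC gh fh) linearZl /= [l * k]mulrC !scalerA mulrCA signzz mulr1 -scalerBl.
rewrite /form_bracket -[RHS]/(wedge (_ *: wedge (f x) (g x)) _) linearZl /=.
by congr (_ *: _); rewrite !intrD; ring.
Qed.

Lemma Omega_wedge_idTM_graded_lie : graded_lie_subalgebra (fun a : int => vOmega M (a + 1))
  (fun a b => NR_bracket (a + 1) (b + 1)) (Omega_wedge_idTM M).
Proof.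
split; first exact: NR_bracket_graded_lie.
- by move=> a _ [f fa <-]; exact: vOmega_wedge_idTM.
- move=> a; split.
    exists 0; first exact: Omega0.
    rewrite wedge_idTME; apply: functional_extensionality_dep => x.
    exact: linear0l.
  move=> r _ _ [f fa <-] [g ga <-]; exists (r *: f + g); first exact: Omega_linear_comb.
  exact: wedge_idTM_linear.
- move=> a b _ _ [f fa <-] [g gb <-]; exists (form_bracket a b f g).
    rewrite /form_bracket -[_ *: _]addr0; apply: Omega_linear_comb; last exact: Omega0.
    exact: Omega_wedge.
  by rewrite wedge_idTM_bracket.
Qed.

Lemma form_wedgeC k l f g : Omega M k f -> Omega M l g ->
  form_wedge f g = (-1 : R) ^ (k * l) *: form_wedge g f.
Proof.
move=> fk gl; apply: functional_extensionality_dep => x.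
have [_ _ fh] := Omega_alt x fk; have [_ _ gh] := Omega_alt x gl.
exact: wedgeC.
Qed.

Lemma form_wedgeA (f g h : dform M) :
  form_wedge (form_wedge f g) h = form_wedge f (form_wedge g h).
Proof. by apply: functional_extensionality_dep => x; exact: wedgeA. Qed.

Lemma form_wedgePl r (f f' g : dform M) :
  form_wedge (r *: f + f') g = r *: form_wedge f g + form_wedge f' g.
Proof. by apply: functional_extensionality_dep => x; exact: linearPl. Qed.

Lemma form_wedgePr r (f g g' : dform M) :
  form_wedge f (r *: g + g') = r *: form_wedge f g + form_wedge f g'.
Proof. by apply: functional_extensionality_dep => x; exact: linearPr. Qed.

Lemma form_wedgeZl r (f g : dform M) : form_wedge (r *: f) g = r *: form_wedge f g.
Proof. by apply: functional_extensionality_dep => x; exact: linearZl. Qed.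

Lemma form_wedgeZr r (f g : dform M) : form_wedge f (r *: g) = r *: form_wedge f g.
Proof. by apply: functional_extensionality_dep => x; exact: linearZr. Qed.

(** The graded Jacobi identity reduces, after reordering the factors, to
(c - b) (b + c - a) = (b - a) (c - a - b) + (c - a) (a + c - b). *)
Lemma form_bracket_graded_lie : graded_lie_algebra (Omega M) form_bracket.
Proof.
split.
- by move=> a; split=> [|r K L]; [exact: Omega0 | exact: Omega_linear_comb].
- move=> a b f g fa gb; rewrite /form_bracket -[_ *: _]addr0.
  by apply: Omega_linear_comb; [exact: Omega_wedge | exact: Omega0].
- move=> a b r f f' g _ _ _; rewrite /form_bracket form_wedgePl scalerDr !scalerA.
  by rewrite mulrC.
- move=> a b r f g g' _ _ _; rewrite /form_bracket form_wedgePr scalerDr !scalerA.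
  by rewrite mulrC.
- move=> a b f g fa gb; rewrite /form_bracket (form_wedgeC fa gb) !scalerA -scaleNr.
  by congr (_ *: _); rewrite !intrB; ring.
- move=> a b c f g h fa gb hc; rewrite /form_bracket !(form_wedgeZl, form_wedgeZr).
  rewrite -[form_wedge g (form_wedge f h)]form_wedgeA (form_wedgeC gb fa) form_wedgeZl.
  rewrite form_wedgeA !scalerA -scalerDl; congr (_ *: _).
  rewrite [b * a]mulrC; have := signzz R (a * b); set p := _ ^ _ => pp.
  rewrite [X in _ = _ + X](_ : _ =
    (p * p) * ((a + c - b)%:~R * (c - a)%:~R)); last by ring.
  by rewrite pp mul1r !(intrB, intrD); ring.
Qed.

(** The trace of f /\ I is a nonzero multiple of f when k <> m, by
[trace_wedge_identity]. *)
Lemma wedge_idTM_inj (k : int) f g : Omega M k f -> Omega M k g -> k != m%:Z ->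
  wedge_idTM f = wedge_idTM g -> f = g.
Proof.
move=> fk gk km; rewrite !wedge_idTME => fg; apply: functional_extensionality_dep => x.
have fgx : wedge (f x) identity_form = wedge (g x) identity_form.
  exact: (congr1 (fun K : forall y : M, seq (tangent y) -> tangent y => K x) fg).
have := congr1 (trace_form (coordinate_vectors (chart_at x) x)
  (coordinate_covectors (chart_at x))) fgx.
rewrite (trace_wedge_identity (frame_at x) (Omega_alt x fk)).
rewrite (trace_wedge_identity (frame_at x) (Omega_alt x gk)) => /(scalerI _); apply.
rewrite mulf_neq0 //; first by case: (signz_cases R k) => ->; rewrite ?oppr_eq0 oner_eq0.
by rewrite -intrB intr_eq0 subr_eq0 eq_sym.
Qed.

Lemma insertion_idTM (k : int) f : Omega M k f -> insertion (idTM M) f = (k%:~R : R) *: f.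
Proof.
move=> fk; apply: functional_extensionality_dep => x.
exact: (insertion_identity (frame_at x) (Omega_alt x fk)).
Qed.

End GradedLieAlgebras.

Theorem theorem3p4 (R : realType) (m : nat) (M : smooth_manifold R m) :
  [/\ graded_lie_subalgebra (fun a : int => vOmega M (a + 1))
        (fun a b => NR_bracket (a + 1) (b + 1))
        (fun a => trace_free M (a + 1)),
      graded_lie_subalgebra (fun a : int => vOmega M (a + 1))
        (fun a b => NR_bracket (a + 1) (b + 1))
        (Omega_wedge_idTM M),
      graded_lie_algebra (Omega M) form_bracket &
      forall (k l : nat) (f g : dform M), Omega M k f -> Omega M l g ->
        [/\ NR_bracket (k%:Z + 1) (l%:Z + 1) (wedge_idTM f) (wedge_idTM g)
              = wedge_idTM (form_bracket k l f g),
            (forall h : dform M, Omega M (k%:Z + l%:Z) h -> (k + l)%N <> m ->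
               wedge_idTM h
                 = NR_bracket (k%:Z + 1) (l%:Z + 1) (wedge_idTM f) (wedge_idTM g) ->
               h = form_bracket k l f g),
            form_bracket k l f g
              = ((l%:Z - k%:Z)%:~R : R) *: form_wedge f g &
            form_bracket k l f g
              = form_wedge f (insertion (idTM M) g)
                - (-1 : R) ^+ (k * l) *: form_wedge g (insertion (idTM M) f)]].
Proof.
split.
- exact: trace_free_graded_lie.
- exact: Omega_wedge_idTM_graded_lie.
- exact: form_bracket_graded_lie.
move=> k l f g fk gl; split=> //.
- exact: wedge_idTM_bracket.
- move=> h hkl klm; rewrite (wedge_idTM_bracket fk gl); apply: wedge_idTM_inj hkl _ _.
    exact: (graded_lie_closed (form_bracket_graded_lie M)).
  by rewrite -PoszD eqz_nat; apply/eqP.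
- rewrite (insertion_idTM fk) (insertion_idTM gl) !form_wedgeZr (form_wedgeC gl fk).
  rewrite /form_bracket !scalerA [l%:Z * k]mulrC -PoszM -exprnP mulrAC -expr2 sqrr_sign mul1r.
  by rewrite -scalerBl -intrB.
Qed.
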